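(* The collection of functions $f\in B(\mathring S^{d-1})$ such that $\mu(K(f))>0$ and, in particular, $\dim_{\rm H}(K(f))=d$, is dense in $B(\mathring S^{d-1})$.
   Context: $\mathring S^{d-1}$ denotes the unit sphere in $\mathbb{R}^d$ with antipodal points identified. $B(\mathring S^{d-1})$ denotes the Banach space of all bounded maps $f:\mathring S^{d-1}\to\mathbb{R}^d$ (no continuity or measurability assumed) with the supremum norm $\|f\|_\infty=\sup_{x}|f(x)|$. For $f\in B(\mathring S^{d-1})$ define \[ K(f)=\bigcup_{x\in\mathring S^{d-1}}\ \bigcup_{t\in[-1/2,1/2]}\{f(x)+tx\}\subseteq\mathbb{R}^d, \] i.e. the union over all directions $x$ of the closed unit line segment in direction $x$ centred at $f(x)$ (this segment does not depend on which of the two antipodal representatives of $x$ is used). $\mu$ denotes $d$-dimensional Lebesgue (outer) measure on $\mathbb{R}^d$ and $\dim_{\rm H}$ the Hausdorff dimension. *)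

(* Defs.v *)
From HB Require Import structures.
From mathcomp Require Import all_boot all_order all_algebra generic_quotient.
From mathcomp Require Import all_classical all_reals all_analysis.
From mathcomp Require Import ring.
Set Implicit Arguments.
Unset Strict Implicit.
Unset Printing Implicit Defensive.
Import Order.TTheory GRing.Theory Num.Theory.
Import numFieldNormedType.Exports.
Local Open Scope classical_set_scope.
Local Open Scope ring_scope.

(* Points of R^d are row vectors.  The library norm `|x| on 'rV[R]_d is the
   maximum norm, hence a separate Euclidean norm. *)
Section euclidean_norm.
Context {R : realType} {d : nat}.
Implicit Types x y : 'rV[R]_d.

Definition enorm x : R := Num.sqrt (\sum_(i < d) x 0 i ^+ 2).

Lemma sumsq_ge0 x : 0 <= \sum_(i < d) x 0 i ^+ 2.
Proof. by apply: sumr_ge0 => i _; exact: sqr_ge0. Qed.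

Lemma enorm_ge0 x : 0 <= enorm x. Proof. exact: sqrtr_ge0. Qed.

Lemma sqr_enorm x : enorm x ^+ 2 = \sum_(i < d) x 0 i ^+ 2.
Proof. by rewrite sqr_sqrtr// sumsq_ge0. Qed.

Lemma enorm0 : enorm 0 = 0.
Proof.
by rewrite /enorm big1 ?sqrtr0// => i _; rewrite mxE expr0n.
Qed.

Lemma enorm_eq0 x : enorm x = 0 -> x = 0.
Proof.
move=> x0; have /eqP : \sum_(i < d) x 0 i ^+ 2 = 0.
  by rewrite -sqr_enorm x0 expr0n.
rewrite psumr_eq0; last by move=> i _; exact: sqr_ge0.
move=> /allP xi0; apply/rowP => i; rewrite mxE.
by apply/eqP; rewrite -sqrf_eq0; exact: xi0 (mem_index_enum i).
Qed.

Lemma enormZ a x : enorm (a *: x) = `|a| * enorm x.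
Proof.
rewrite /enorm; under eq_bigr do rewrite mxE exprMn.
by rewrite -mulr_sumr sqrtrM ?sqr_ge0// sqrtr_sqr.
Qed.

Lemma cauchy_schwarz x y : \sum_(i < d) x 0 i * y 0 i <= enorm x * enorm y.
Proof.
have [/enorm_eq0 ->|x0] := eqVneq (enorm x) 0.
  by rewrite enorm0 mul0r big1// => i _; rewrite mxE mul0r.
have [/enorm_eq0 ->|y0] := eqVneq (enorm y) 0.
  by rewrite enorm0 mulr0 big1// => i _; rewrite mxE mulr0.
set a := enorm x; set b := enorm y.
have ab0 : 0 < a * b by rewrite mulr_gt0// lt_neqAle eq_sym ?x0 ?y0 enorm_ge0.
have : 0 <= \sum_(i < d) (b * x 0 i - a * y 0 i) ^+ 2.
  by apply: sumr_ge0 => i _; exact: sqr_ge0.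
under eq_bigr => i _.
  rewrite (_ : _ ^+ 2 = b ^+ 2 * x 0 i ^+ 2 + a ^+ 2 * y 0 i ^+ 2
    - 2 * (a * b) * (x 0 i * y 0 i)); last by ring.
  over.
rewrite sumrB big_split/= -!mulr_sumr -!sqr_enorm -/a -/b.
set s := \sum_(i < d) x 0 i * y 0 i.
have -> : b ^+ 2 * a ^+ 2 + a ^+ 2 * b ^+ 2 - 2 * (a * b) * s =
  (a * b * 2) * (a * b - s) by ring.
by rewrite pmulr_rge0 ?subr_ge0// mulr_gt0.
Qed.

Lemma ler_enormD x y : enorm (x + y) <= enorm x + enorm y.
Proof.
rewrite -(@ler_pXn2r _ 2)// ?nnegrE ?addr_ge0 ?enorm_ge0//.
rewrite sqr_enorm; under eq_bigr do rewrite mxE sqrrD.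
rewrite !big_split/= -mulr2n sqrrD !sqr_enorm lerD2r lerD2l.
by rewrite ler_wMn2r// cauchy_schwarz.
Qed.

End euclidean_norm.

Section projective_sphere.
Variables (R : realType) (d : nat).

Definition sphere : Type := {x : 'rV[R]_d | enorm x == 1}.

HB.instance Definition _ := Choice.on sphere.

Definition antipodal : rel sphere :=
  fun u v => (val u == val v) || (val u == - val v).

Lemma antipodal_refl : reflexive antipodal.
Proof. by move=> u; rewrite /antipodal eqxx. Qed.

Lemma antipodal_sym : symmetric antipodal.
Proof.
by move=> u v; rewrite /antipodal eq_sym [X in _ || X]eq_sym eqr_oppLR.
Qed.

Lemma antipodal_trans : transitive antipodal.
Proof.
move=> v u w /orP[] /eqP uv /orP[] /eqP vw; apply/orP; rewrite uv vw.
- by left.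
- by right.
- by right.
- by left; rewrite opprK.
Qed.

Canonical antipodal_equiv :=
  EquivRel antipodal antipodal_refl antipodal_sym antipodal_trans.

Definition psphere : Type := {eq_quot antipodal_equiv}%qT.

Definition to_psphere (u : sphere) : psphere :=
  (\pi_({eq_quot antipodal_equiv}) u)%qT.

End projective_sphere.

Section bounded_maps.
Variables (R : realType) (d : nat).

Definition bmap_pred : {pred psphere R d -> 'rV[R]_d} :=
  fun f => `[< exists M : R, forall x, enorm (f x) <= M >].

Record bmap : Type := BMap {
  bmap_fun :> psphere R d -> 'rV[R]_d ;
  _ : bmap_fun \in bmap_pred }.

Lemma bmap_submod_closed : submod_closed bmap_pred.
Proof.
split.
  by apply/asboolP; exists 0 => x; rewrite enorm0.
move=> a f g /asboolP[M fM] /asboolP[N gN].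
apply/asboolP; exists (`|a| * M + N) => x.
apply: le_trans (ler_enormD _ _) _.
by rewrite lerD// enormZ ler_wpM2l.
Qed.

HB.instance Definition _ := [isSub for bmap_fun].
HB.instance Definition _ := [Choice of bmap by <:].
HB.instance Definition _ :=
  GRing.isSubmodClosed.Build _ _ bmap_pred bmap_submod_closed.
HB.instance Definition _ := [SubChoice_isSubLmodule of bmap by <:].

Definition supnorm (f : bmap) : R :=
  sup [set enorm (f x) | x in [set: psphere R d]].

Lemma bmap_bounded (f : bmap) :
  has_ubound [set enorm (f x) | x in [set: psphere R d]].
Proof.
by have /asboolP[M fM] := valP f; exists M => _ [x _ <-]; exact: fM.
Qed.

Lemma enorm_supnorm (f : bmap) x : enorm (f x) <= supnorm f.
Proof. by apply: ub_le_sup; [exact: bmap_bounded|exists x]. Qed.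

Lemma supnorm_ge0 f : 0 <= supnorm f.
Proof.
have [f0|/set0P[_ [x _ _]]] :=
    eqVneq [set enorm (f x) | x in [set: psphere R d]] set0.
  by rewrite /supnorm f0 sup0.
exact: le_trans (enorm_ge0 (f x)) (enorm_supnorm f x).
Qed.

Lemma supnorm_le (f : bmap) M :
  0 <= M -> (forall x, enorm (f x) <= M) -> supnorm f <= M.
Proof.
move=> M0 fM; have [f0|/set0P fn0] :=
    eqVneq [set enorm (f x) | x in [set: psphere R d]] set0.
  by rewrite /supnorm f0 sup0.
by apply: ge_sup => // _ [x _ <-]; exact: fM.
Qed.

Lemma ler_supnormD f g : supnorm (f + g) <= supnorm f + supnorm g.
Proof.
apply: supnorm_le => [|x]; first by rewrite addr_ge0// supnorm_ge0.
by apply: le_trans (ler_enormD _ _) _; rewrite lerD// enorm_supnorm.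
Qed.

Lemma supnormZ a f : supnorm (a *: f) = `|a| * supnorm f.
Proof.
have leZ b h : supnorm (b *: h) <= `|b| * supnorm h.
  apply: supnorm_le => [|x]; first by rewrite mulr_ge0// supnorm_ge0.
  by rewrite enormZ ler_wpM2l// enorm_supnorm.
apply/eqP; rewrite eq_le leZ/=.
have [->|a0] := eqVneq a 0; first by rewrite normr0 mul0r supnorm_ge0.
have := leZ a^-1 (a *: f); rewrite scalerA mulVf// scale1r normfV.
by rewrite ler_pdivlMl// normr_gt0.
Qed.

Lemma supnorm_eq0 f : supnorm f = 0 -> f = 0.
Proof.
move=> f0; apply/val_inj/funext => x; apply: enorm_eq0.
by apply/eqP; rewrite eq_le enorm_ge0 andbT -f0 enorm_supnorm.
Qed.

HB.instance Definition _ :=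
  @Lmodule_isNormed.Build R bmap supnorm ler_supnormD supnormZ supnorm_eq0.

End bounded_maps.

(* The union runs over all unit vectors u; u and -u give the same segment. *)
Definition kakeya_set {R : realType} {d : nat} (f : bmap R d) : set 'rV[R]_d :=
  \bigcup_(u in [set: sphere R d]) \bigcup_(t in `[- 2^-1, 2^-1]%classic)
    [set f (to_psphere u) + t *: val u].

Section lebesgue_outer.
Context {R : realType} {d : nat}.
Local Open Scope ereal_scope.

Definition box (B : 'rV[R]_d * 'rV[R]_d) : set 'rV[R]_d :=
  [set x | forall i, (B.1 0 i <= x 0 i <= B.2 0 i)%R].

Definition box_volume (B : 'rV[R]_d * 'rV[R]_d) : R :=
  (\prod_(i < d) (B.2 0 i - B.1 0 i))%R.

Definition box_cover (A : set 'rV[R]_d) :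
    set (nat -> 'rV[R]_d * 'rV[R]_d) :=
  [set B : nat -> 'rV[R]_d * 'rV[R]_d |
           (forall k i, (B k).1 0 i <= (B k).2 0 i)%R /\
           A `<=` \bigcup_k box (B k)].

Definition lebesgue_outer (A : set 'rV[R]_d) : \bar R :=
  ereal_inf [set \sum_(0 <= k <oo) (box_volume (B k))%:E | B in box_cover A].

End lebesgue_outer.

Section hausdorff_dimension.
Context {R : realType} {d : nat}.
Local Open Scope ereal_scope.

Definition diameter (U : set 'rV[R]_d) : \bar R :=
  ereal_sup [set (enorm (p.1 - p.2)%R)%:E | p in U `*` U].

(* The empty set has weight 0 also for s = 0, where poweR would give 1. *)
Definition hausdorff_weight (s : R) (U : set 'rV[R]_d) : \bar R :=
  if U == set0 then 0 else diameter U `^ s.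

Definition hausdorff_premeasure (s delta : R) (A : set 'rV[R]_d) : \bar R :=
  ereal_inf [set \sum_(0 <= k <oo) hausdorff_weight s (U k) |
    U in [set U : nat -> set 'rV[R]_d |
      A `<=` \bigcup_k U k /\ forall k, diameter (U k) <= delta%:E]].

Definition hausdorff_measure (s : R) (A : set 'rV[R]_d) : \bar R :=
  ereal_sup [set hausdorff_premeasure s delta A |
    delta in [set delta : R | (0 < delta)%R]].

Definition hausdorff_dim (A : set 'rV[R]_d) : \bar R :=
  ereal_inf [set s%:E |
    s in [set s : R | (0 <= s)%R /\ hausdorff_measure s A = 0]].

End hausdorff_dimension.

(* Main.v *)
Require Import Defs.
From mathcomp Require Import all_boot all_order all_algebra.
From mathcomp Require Import all_classical all_reals all_analysis measurable_realfun.
From mathcomp Require Import ring lra.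
Import Order.TTheory GRing.Theory Num.Theory.
Import numFieldNormedType.Exports.
Local Open Scope classical_set_scope.
Local Open Scope ring_scope.

(** If [g] takes only countably many values [c k], then [kakeya_set g] is
    large: a nonzero point [x] of the ball of radius 1/2 lies on the centred
    unit segment in its own direction, so [x + c k] lies in [kakeya_set g] for
    the [k] such that [g] equals [c k] in that direction. Hence countably many
    translates of [kakeya_set g] cover a cube. Outer measure being countably
    subadditive and invariant under translation, and a cube not being null,
    [kakeya_set g] has positive outer measure. Maps with countably many values
    are dense: round the values of an arbitrary bounded map to a fine grid.

    Three facts about outer measure carry this argument:
    [lebesgue_outer_sigma_subadditive], [lebesgue_outer_translate] and
    [lebesgue_outer_cube]. The last one is proved by induction on the
    dimension, integrating one coordinate at a time in [weighted_box_series].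

    The dimension is then determined by two comparisons. A set of diameter
    [r <= 1] sits in a cube of volume [(2 r) ^+ d <= 2 ^+ d * r `^ s] as soon
    as [s <= d], so a set with vanishing [s]-dimensional Hausdorff measure for
    some [s < d] is Lebesgue null. Conversely a bounded set is covered by
    [N ^ d] cells of diameter [O(1 / N)], and [N ^ d * N ^ (- s)] tends to [0]
    when [s > d]. *)

(** * Euclidean norm and coordinates *)

Lemma ler_coord_enorm (R : realType) (d : nat) (x : 'rV[R]_d) i :
  `|x 0 i| <= enorm x.
Proof.
rewrite -sqrtr_sqr; apply: ler_wsqrtr.
by rewrite (bigD1 i)//= lerDl sumr_ge0// => j _; exact: sqr_ge0.
Qed.

Lemma enorm_le_coord (R : realType) (d : nat) (x : 'rV[R]_d) (r : R) :
  (forall i, `|x 0 i| <= r) -> 0 <= r -> enorm x <= d%:R * r.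
Proof.
move=> xr r0; rewrite -(@ler_pXn2r _ 2)// ?nnegrE ?enorm_ge0 ?mulr_ge0//.
rewrite sqr_enorm (@le_trans _ _ (\sum_(i < d) r ^+ 2))//.
  apply: ler_sum => i _.
  by rewrite -[x 0 i ^+ 2]real_normK ?num_real// ler_pXn2r// nnegrE.
rewrite sumr_const card_ord exprMn -[leLHS]mulr_natl ler_wpM2r ?sqr_ge0//.
by rewrite -natrX ler_nat; case: (d) => // n; rewrite expnS leq_pmulr.
Qed.

(** * Lebesgue outer measure *)

Section lebesgue_outer_theory.
Context {R : realType} {d : nat}.
Implicit Types (A : set 'rV[R]_d) (B : nat -> 'rV[R]_d * 'rV[R]_d).

Lemma box_volume_ge0 A B k : box_cover A B -> 0 <= box_volume (B k).
Proof. by move=> [B0 _]; apply: prodr_ge0 => i _; rewrite subr_ge0. Qed.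

Lemma lebesgue_outer_ge0 A : (0 <= lebesgue_outer A)%E.
Proof.
apply: le_ereal_inf_tmp => _ [B AB <-].
by apply: nneseries_ge0 => k _ _; rewrite lee_fin (box_volume_ge0 _ _ _ AB).
Qed.

Lemma le_lebesgue_outer A1 A2 : A1 `<=` A2 ->
  (lebesgue_outer A1 <= lebesgue_outer A2)%E.
Proof.
move=> A12; apply: le_ereal_inf_tmp => _ [B [B0 A2B] <-].
by apply: ereal_inf_lbound; exists B => //; split => //; exact: subset_trans A2B.
Qed.

Lemma lebesgue_outer_translate A v :
  (lebesgue_outer [set (x + v)%R | x in A] <= lebesgue_outer A)%E.
Proof.
apply: le_ereal_inf_tmp => _ [B [B0 AB] <-].
apply: ereal_inf_lbound; exists (fun k => ((B k).1 + v, (B k).2 + v)).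
  split => [k i|_ [x Ax <-]] /=; first by rewrite !mxE lerD2r.
  by have [k _ xk] := AB x Ax; exists k => // i /=; rewrite !mxE !lerD2r.
apply: eq_eseriesr => k _; congr EFin; apply: eq_bigr => i _ /=.
by rewrite !mxE; ring.
Qed.

(** Near-optimal covers of the [A n], with errors [e / 2 ^ n.+1], are merged
    into a single sequence of boxes along a bijection of [nat] with
    [nat * nat]. *)
Lemma lebesgue_outer_sigma_subadditive (A : nat -> set 'rV[R]_d) :
  (lebesgue_outer (\bigcup_n A n) <=
    \sum_(0 <= n <oo) lebesgue_outer (A n))%E.
Proof.
have [[i ioo]|] := pselect (exists i, lebesgue_outer (A i) = +oo%E).
  rewrite (eseries_pinfty _ _ ioo) ?leey// => n _.
  by rewrite -ltNye (lt_le_trans _ (lebesgue_outer_ge0 _)).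
rewrite -forallNE => Aoo; apply/lee_addgt0Pr => e e0.
have e2n0 n : 0 < e / (2 ^ n.+1)%:R by rewrite divr_gt0// ltr0n expn_gt0.
apply: le_trans (epsilon_trick _ (fun n => lebesgue_outer_ge0 (A n)) (ltW e0)).
have [G PG] : {G : nat -> nat -> 'rV[R]_d * 'rV[R]_d & forall n,
    box_cover (A n) (G n) /\ (\sum_(0 <= k <oo) (box_volume (G n k))%:E <=
      lebesgue_outer (A n) + (e / (2 ^ n.+1)%:R)%:E)%E}.
  apply: (@choice _ _ (fun n Gn => box_cover (A n) Gn /\
    (\sum_(0 <= k <oo) (box_volume (Gn k))%:E <=
      lebesgue_outer (A n) + (e / (2 ^ n.+1)%:R)%:E)%E)) => n.
  have fin : lebesgue_outer (A n) \is a fin_num.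
    rewrite ge0_fin_numE ?lebesgue_outer_ge0// ltey; exact/eqP/Aoo.
  have [_ [B AB <-] /ltW ltB] := lb_ereal_inf_adherent (e2n0 n) fin.
  by exists B.
have G0 n k : (0 <= (box_volume (G n k))%:E)%E.
  by rewrite lee_fin (box_volume_ge0 _ _ _ (PG n).1).
have /card_esym/ppcard_eqP[f] := card_nat2.
apply: (@le_trans _ _ (\sum_(0 <= m <oo)
    (box_volume (G (f m).1 (f m).2))%:E)%E).
  apply: ereal_inf_lbound; exists (fun m => G (f m).1 (f m).2) => //.
  split => [m i|x [n _ Anx]]; first exact: (PG _).1.1.
  have [k _ xk] := (PG n).1.2 x Anx.
  by exists (f^-1%FUN (n, k)) => //; rewrite invK ?inE.
rewrite nneseries_esumT; last by move=> m; exact: G0.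
rewrite -(reindex_esum setT setT f (fun nk => (box_volume (G nk.1 nk.2))%:E))//.
rewrite [X in esum X _](_ : _ = setT `*`` (fun=> setT)); last first.
  by apply/seteqP; split => -[].
rewrite -(esum_esum (a := fun n k => (box_volume (G n k))%:E)) => [|n k _ _//].
rewrite -nneseries_esumT => [|n]; last by apply: esum_ge0.
apply: lee_nneseries => n => [_ _|_]; first exact: esum_ge0.
by rewrite -nneseries_esumT//; exact: (PG n).2.
Qed.

End lebesgue_outer_theory.

(** This is Fubini for a series of indicators of boxes, in a form that uses only
    one-dimensional integrals. Fixing the last coordinate [y] turns the series
    into one of the same kind in dimension [n], with [\1_(I k) y] absorbed in
    the weights; this is why arbitrary weights are allowed. The induction
    hypothesis then bounds the slice at [y] from below, and integrating over
    [y] turns each indicator into at most the length of [I k]. Points and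
    boxes are indexed by [nat] so that every dimension uses the same type. *)
Lemma weighted_box_series (R : realType) (n : nat) (w : nat -> R)
    (a b : nat -> nat -> R) (c l u : R) :
    (forall k, 0 <= w k) -> (forall k i, a k i <= b k i) -> 0 <= c -> l <= u ->
    (forall x : nat -> R, (forall i, l <= x i <= u) ->
      (c%:E <= \sum_(0 <= k <oo)
        (w k * \prod_(i < n) \1_(`[a k i, b k i]%classic) (x i))%:E)%E) ->
  ((c * (u - l) ^+ n)%:E <=
    \sum_(0 <= k <oo) (w k * \prod_(i < n) (b k i - a k i))%:E)%E.
Proof.
elim: n w c => [|n IHn] w c w0 ab c0 lu cover.
  rewrite expr0 mulr1; apply: le_trans (cover (fun=> l) _) _.
    by move=> i; rewrite lexx.
  by apply: lee_nneseries => k *; rewrite !big_ord0// lee_fin mulr1.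
pose I k : set R := `[a k n, b k n]%classic.
pose v k := w k * \prod_(i < n) (b k i - a k i).
have v0 k : 0 <= v k.
  by rewrite mulr_ge0// prodr_ge0// => i _; rewrite subr_ge0.
have slice y : l <= y <= u -> ((c * (u - l) ^+ n)%:E <=
    \sum_(0 <= k <oo) ((v k)%:E * (\1_(I k) y)%:E))%E.
  move=> ly; apply: le_trans (IHn (fun k => w k * \1_(I k) y) c _ ab c0 lu _) _.
  - by move=> k; rewrite mulr_ge0.
  (* x' extends the n coordinates of x by y *)
  - move=> x lx; pose x' i := if i == n then y else x i.
    apply: le_trans (cover x' _) _.
      by move=> i; rewrite /x'; case: ifP.
    rewrite le_eqVlt; apply/orP; left; apply/eqP.
    apply: eq_eseriesr => k _; congr EFin.
    have -> : \prod_(i < n) \1_(`[a k i, b k i]%classic) (x i) =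
        \prod_(i < n) \1_(`[a k i, b k i]%classic) (x' i) :> R.
      by apply: eq_bigr => i _; rewrite /x' ltn_eqF.
    by rewrite big_ord_recr/= {2}/x' eqxx -/(I k); ring.
  - rewrite le_eqVlt; apply/orP; left; apply/eqP.
    by apply: eq_eseriesr => k _; rewrite -EFinM /v; congr EFin; ring.
have mI k : measurable (I k) by exact: measurable_itv.
have mD : measurable (`[l, u]%classic : set R) by exact: measurable_itv.
have mindic k : measurable_fun `[l, u]%classic (fun y => (\1_(I k) y : R)%:E).
  by apply/measurable_EFinP; exact: measurable_indic.
have mterm k : measurable_fun `[l, u]%classic
    (fun y => (v k)%:E * (\1_(I k) y)%:E)%E.
  exact: measurable_funeM.
have term0 k y : (0 <= (v k)%:E * (\1_(I k) y)%:E)%E.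
  by rewrite -EFinM lee_fin mulr_ge0.
have : (\int[@lebesgue_measure R]_(y in `[l, u]) cst (c * (u - l) ^+ n)%:E y <=
   \int[@lebesgue_measure R]_(y in `[l, u])
     \sum_(0 <= k <oo) ((v k)%:E * (\1_(I k) y)%:E))%E.
  apply: ge0_le_integral => //.
  - by move=> y _; rewrite lee_fin mulr_ge0// exprn_ge0// subr_ge0.
  - by apply: ge0_emeasurable_sum => [k y|k] *; [exact: term0|exact: mterm].
rewrite integral_cst//= integral_nneseries//=.
have -> : lebesgue_measure (`[l, u]%classic : set R) = (u - l)%:E.
  rewrite lebesgue_measure_itv/= lte_fin; case: ltP => [//|ul].
  by congr EFin; apply/eqP; rewrite eq_sym subr_eq0 eq_le ul lu.
rewrite -EFinM -mulrA -exprSr => /le_trans; apply.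
apply: lee_nneseries => k => [_ _|_]; first exact: integral_ge0.
rewrite ge0_integralZl_EFin//; last exact: mindic.
rewrite integral_indic//; last exact: mI.
have -> : w k * \prod_(i < n.+1) (b k i - a k i) = v k * (b k n - a k n).
  by rewrite big_ord_recr/= mulrA.
rewrite [leRHS]EFinM; apply: lee_wpmul2l; first by rewrite lee_fin.
apply: (@le_trans _ _ (lebesgue_measure (I k))).
  apply: le_measure; rewrite ?inE; last exact: subIsetl.
  - by apply: measurableI; [exact: mI|exact: mD].
  - exact: mI.
rewrite lebesgue_measure_itv/= lte_fin; case: ltP => //.
by rewrite lee_fin subr_ge0.
Qed.

(** Over a cover of the cube, the indicators of the boxes add up to at least
    [1], so [weighted_box_series] applies with unit weights. *)
Lemma lebesgue_outer_cube (R : realType) (d : nat) (l u : R) : l <= u ->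
  (((u - l) ^+ d)%:E <=
    lebesgue_outer [set x : 'rV[R]_d | forall i, (l <= x 0 i <= u)%R])%E.
Proof.
move=> lu; apply: le_ereal_inf_tmp => _ [B [B0 AB] <-].
(* coordinates beyond d get the degenerate interval [l, l] *)
pose a k i := oapp ((B k).1 0) l (insub i).
pose b k i := oapp ((B k).2 0) l (insub i).
have aE k (i : 'I_d) : a k i = (B k).1 0 i by rewrite /a valK.
have bE k (i : 'I_d) : b k i = (B k).2 0 i by rewrite /b valK.
have ab k i : a k i <= b k i.
  by rewrite /a /b; case: insubP => //= j _ _; exact: B0.
have := @weighted_box_series R d (fun=> 1) a b 1 l u (fun=> ler01) ab ler01 lu.
rewrite mul1r => /(_ _)/le_trans; apply; last first.
  apply: lee_nneseries => k => [_ _|_].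
    by rewrite lee_fin mul1r prodr_ge0// => i _; rewrite subr_ge0.
  by rewrite lee_fin mul1r /box_volume; under eq_bigr do rewrite aE bE.
move=> x lx; have [|k _ xk] := AB (\row_i x i).
  by move=> i; rewrite mxE; exact: lx.
have term0 j : (0 <= (1 * \prod_(i < d)
    \1_(`[a j i, b j i]%classic) (x i))%:E :> \bar R)%E.
  by rewrite lee_fin mul1r prodr_ge0.
rewrite (nneseries_split 0 k.+1)// add0n big_nat_recr//=.
rewrite -[leLHS]adde0 leeD ?nneseries_ge0//.
rewrite -[leLHS]add0e leeD ?sume_ge0//.
rewrite lee_fin mul1r big1// => i _.
by rewrite indicE mem_set//= in_itv/= aE bE; have := xk i; rewrite mxE.
Qed.

(** * Hausdorff measure and dimension *)

Section hausdorff_theory.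
Context {R : realType} {d : nat}.
Implicit Types (A U : set 'rV[R]_d) (s : R).

Lemma diameter_ubound U x y : U x -> U y ->
  ((enorm (x - y))%:E <= diameter U)%E.
Proof. by move=> Ux Uy; apply: ereal_sup_ubound; exists (x, y). Qed.

Lemma diameter_ge0 U : U !=set0 -> (0 <= diameter U)%E.
Proof.
move=> [x Ux]; apply: le_trans (diameter_ubound _ _ _ Ux Ux).
by rewrite lee_fin enorm_ge0.
Qed.

Lemma hausdorff_weight_ge0 s U : (0 <= hausdorff_weight s U)%E.
Proof. by rewrite /hausdorff_weight; case: ifP => // _; exact: poweR_ge0. Qed.

Lemma hausdorff_premeasure_ge0 s delta A :
  (0 <= hausdorff_premeasure s delta A)%E.
Proof.
apply: le_ereal_inf_tmp => _ [U _ <-].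
by apply: nneseries_ge0 => k _ _; exact: hausdorff_weight_ge0.
Qed.

Lemma hausdorff_premeasure_le_measure s delta A : 0 < delta ->
  (hausdorff_premeasure s delta A <= hausdorff_measure s A)%E.
Proof. by move=> delta0; apply: ereal_sup_ubound; exists delta. Qed.

(** A set of diameter [r] lies in the cube of side [2 * r] centred at any of its
    points, and [r ^+ d <= r `^ s] because [r <= 1]. The scale [1] is enough
    since smaller scales only increase the premeasure. *)
Lemma lebesgue_outer_le_premeasure s A : (0 < d)%N -> s <= d%:R ->
  (lebesgue_outer A <= (2 ^+ d)%:E * hausdorff_premeasure s 1 A)%E.
Proof.
move=> d0 sd; have p2 : 0 < 2 ^+ d :> R by rewrite exprn_gt0.
rewrite -lee_pdivrMl//; apply: le_ereal_inf_tmp => _ [U [AU U1] <-].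
rewrite lee_pdivrMl// -nneseriesZl => [|k _]; last exact: hausdorff_weight_ge0.
pose r k := fine (diameter (U k)).
have rE k : U k !=set0 -> (r k)%:E = diameter (U k) /\ 0 <= r k <= 1.
  move=> /diameter_ge0 Uk0; have Uk1 := U1 k.
  have rE : (r k)%:E = diameter (U k).
    by rewrite fineK// ge0_fin_numE// (le_lt_trans Uk1) ?ltry.
  by rewrite -!lee_fin rE Uk0 Uk1.
(* the diameter of the empty set is -oo, which fine sends to 0 *)
have r00 k : U k = set0 -> r k = 0.
  by move=> Uk0; rewrite /r Uk0 /diameter set0X image_set0 ereal_sup0.
have r0 k : 0 <= r k.
  have [/r00 ->//|/set0P/rE[_ /andP[]//]] := eqVneq (U k) set0.
pose p k : 'rV[R]_d := xget 0 (U k).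
pose B k := (p k - const_mx (r k), p k + const_mx (r k)).
apply: (@le_trans _ _ (\sum_(0 <= k <oo) (box_volume (B k))%:E)%E).
  apply: ereal_inf_lbound; exists B => //; split.
    by move=> k i; rewrite !mxE lerD2l (le_trans _ (r0 k))// oppr_le0.
  move=> x /AU[k _ Ukx]; exists k => // i; rewrite !mxE.
  have Up : U k (p k) by exact: xgetI Ukx.
  have [rk _] := rE k (ex_intro _ x Ukx).
  rewrite -ler_distl.
  have := ler_coord_enorm _ _ (x - p k) i; rewrite !mxE => /le_trans; apply.
  by rewrite -lee_fin rk; exact: diameter_ubound.
have volE k : box_volume (B k) = (2 * r k) ^+ d.
  rewrite /box_volume -[d in RHS]card_ord -prodr_const; apply: eq_bigr => i _.
  by rewrite !mxE; ring.
apply: lee_nneseries => k => [_ _|_].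
  by rewrite lee_fin volE exprn_ge0// mulr_ge0.
rewrite volE exprMn EFinM; apply: lee_wpmul2l; first by rewrite lee_fin ltW.
rewrite /hausdorff_weight; case: eqP => [/r00 ->|/eqP/set0P/rE[<- /andP[_ r1]]].
  by rewrite expr0n gtn_eqF.
rewrite poweR_EFin lee_fin.
have := r0 k; rewrite le_eqVlt => /predU1P[<-|rk0].
  by rewrite expr0n gtn_eqF// powR_ge0.
by rewrite -powR_mulrn//; apply: ger_powR; rewrite ?rk0.
Qed.

(** The family is enumerated and padded with the empty set, whose weight
    is [0]. *)
Lemma hausdorff_premeasure_finite_cover (T : finType) (U : T -> set 'rV[R]_d)
    s delta A : 0 < delta ->
    A `<=` \bigcup_j U j -> (forall j, (diameter (U j) <= delta%:E)%E) ->
  (hausdorff_premeasure s delta A <= \sum_(j : T) hausdorff_weight s (U j))%E.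
Proof.
move=> delta0 AU Udelta.
pose V k := if insub k is Some i then U (@enum_val T predT i) else set0.
have VE (i : 'I_#|T|) : V i = U (enum_val i) by rewrite /V valK.
have V0 k : (#|T| <= k)%N -> V k = set0.
  by move=> Tk; rewrite /V insubF// ltnNge Tk.
apply: (@le_trans _ _ (\sum_(0 <= k <oo) hausdorff_weight s (V k))%E).
  apply: ereal_inf_lbound; exists V => //; split.
    move=> x /AU[j _ Ujx]; exists (enum_rank j) => //.
    by rewrite VE enum_rankK.
  move=> k; rewrite /V; case: insubP => // _.
  by rewrite /diameter set0X image_set0 ereal_sup0 leNye.
rewrite (nneseries_split 0 #|T|) => [|k _]; last exact: hausdorff_weight_ge0.
rewrite add0n [X in (_ + X)%E]eseries0 => [|k Tk _]; last first.
  by rewrite /hausdorff_weight V0// eqxx.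
rewrite adde0 big_mkord (reindex (@enum_val T predT))/=; last first.
  by apply: onW_bij; exact: enum_val_bij.
by rewrite le_eqVlt; apply/orP; left; apply/eqP; apply: eq_bigr => i _; rewrite VE.
Qed.

(** The cube of side [2 * M] is cut into [N ^ d] cells of diameter at most
    [C / N], with [C = d * (2 * M)]; their total weight is at most
    [N ^ d * (C / N) `^ s = C `^ s / N `^ (s - d)], which is small for
    large [N]. *)
Lemma hausdorff_measure_bounded0 s M A : d%:R < s -> 0 < M ->
  (forall x, A x -> forall i, `|x 0 i| < M) -> hausdorff_measure s A = 0%E.
Proof.
move=> ds M0 AM; have s0 : 0 < s by apply: le_lt_trans ds.
apply/eqP; rewrite eq_le; apply/andP; split; last first.
  by apply: le_trans (hausdorff_premeasure_le_measure s _ A ltr01);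
    exact: hausdorff_premeasure_ge0.
apply: ge_ereal_sup => _ [delta /= delta0 <-].
apply/lee_addgt0Pr => e e0; rewrite add0e.
pose C := d%:R * (2 * M).
have C0 : 0 <= C by rewrite mulr_ge0// mulr_ge0// ltW.
have sd0 : 0 < s - d%:R by rewrite subr_gt0.
have [N [N0 CN sumN]] : exists N : nat, [/\ 0 < N%:R :> R, C / N%:R <= delta &
    N%:R ^+ d * (C / N%:R) `^ s <= e].
  (* b solves C `^ s / b `^ (s - d) = e *)
  pose b := (C `^ s / e) `^ (s - d%:R)^-1.
  have b0 : 0 <= b by exact: powR_ge0.
  pose N := (Num.truncn (C / delta + b)).+1.
  have bN : C / delta + b < N%:R by rewrite truncnS_gt.
  have Cd0 : 0 <= C / delta by rewrite divr_ge0// ltW.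
  have N0 : 0 < N%:R :> R by rewrite ltr0n.
  exists N; split => //.
    rewrite ler_pdivrMr// mulrC -ler_pdivrMr// ltW// (le_lt_trans _ bN)//.
    by rewrite lerDl.
  have NE : N%:R `^ s = N%:R ^+ d * N%:R `^ (s - d%:R) :> R.
    rewrite -powR_mulrn ?ltW// -powRD ?subrKC//.
    by rewrite gt_eqF ?implybT.
  have -> : (C / N%:R) `^ s = C `^ s / N%:R `^ s.
    apply: (mulIf (lt0r_neq0 (powR_gt0 s N0))).
    rewrite -powRM ?divr_ge0 ?(ltW N0)// divfK ?gt_eqF//.
    by rewrite divfK// gt_eqF// powR_gt0.
  rewrite NE.
  have Nd0 : 0 < N%:R ^+ d :> R by rewrite exprn_gt0.
  have Ns0 : 0 < N%:R `^ (s - d%:R) :> R by rewrite powR_gt0.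
  have -> : N%:R ^+ d * (C `^ s / (N%:R ^+ d * N%:R `^ (s - d%:R))) =
      C `^ s / N%:R `^ (s - d%:R).
    by field; rewrite !gt_eqF.
  rewrite ler_pdivrMr// mulrC -ler_pdivrMr//.
  have -> : C `^ s / e = b `^ (s - d%:R).
    rewrite -powRrM mulVf ?gt_eqF// powRr1// divr_ge0 ?powR_ge0 ?ltW//.
  apply: ge0_ler_powR; rewrite ?nnegrE ?(ltW sd0) ?(ltW N0)//.
  by rewrite ltW// (le_lt_trans _ bN)// lerDr.
(* the coordinates of x, shifted by M, in units of the side 2 * M / N of a cell *)
pose U (j : {ffun 'I_d -> 'I_N}) := [set x : 'rV[R]_d |
  forall i, (j i)%:R <= (x 0 i + M) * (N%:R / (2 * M)) <= (j i).+1%:R].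
have M20 : 0 < 2 * M by rewrite mulr_gt0.
have diamU j : (diameter (U j) <= (C / N%:R)%:E)%E.
  apply: ge_ereal_sup => _ [[x y] [/= Ux Uy] <-]; rewrite lee_fin.
  rewrite /C -mulrA; apply: enorm_le_coord => [i|]; last first.
    by rewrite divr_ge0// ltW.
  have /andP[x1 x2] := Ux i; have /andP[y1 y2] := Uy i.
  have q0 : 0 < N%:R / (2 * M) by rewrite divr_gt0.
  rewrite !mxE -[leRHS]invf_div -(ler_pM2r q0) mulVf ?gt_eqF//.
  rewrite -{1}(gtr0_norm q0) -normrM ler_norml.
  move: x1 x2 y1 y2; rewrite -!natr1.
  set q := N%:R / (2 * M); rewrite !mulrDl mulNr; lra.
apply: (@le_trans _ _ (\sum_(j : {ffun 'I_d -> 'I_N})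
    hausdorff_weight s (U j))%E).
  apply: hausdorff_premeasure_finite_cover => // [x Ax|j]; last first.
    by apply: le_trans (diamU j) _; rewrite lee_fin.
  have cell i : exists k : 'I_N,
      k%:R <= (x 0 i + M) * (N%:R / (2 * M)) <= k.+1%:R.
    have := AM x Ax i; rewrite ltr_norml => /andP[xM Mx].
    set y := (x 0 i + M) * _.
    have y0 : 0 <= y.
      by rewrite mulr_ge0// ?divr_ge0// ?ltW//; rewrite -(addNr M) ltrD2r.
    have yN : y < N%:R.
      rewrite /y mulrCA gtr_pMr// -/(_ / _) ltr_pdivrMr// mul1r; lra.
    have /andP[y1 y2] := truncn_itv y0.
    have kN : (Num.truncn y < N)%N by rewrite -(ltr_nat R) (le_lt_trans y1).
    by exists (Ordinal kN); rewrite y1 ltW.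
  have [j jP] := @choice _ _ (fun i (k : 'I_N) => _) cell.
  by exists (finfun j) => // i; rewrite ffunE; exact: jP.
have weightU j : (hausdorff_weight s (U j) <= ((C / N%:R) `^ s)%:E)%E.
  rewrite /hausdorff_weight; case: ifPn => [_|/set0P Uj].
    by rewrite lee_fin powR_ge0.
  rewrite -poweR_EFin; apply: gt0_ler_poweR; first exact: ltW.
  - by rewrite in_itv/= leey diameter_ge0.
  - by rewrite in_itv/= leey lee_fin divr_ge0.
  - exact: diamU.
apply: le_trans (lee_sum _ (fun j _ => weightU j)) _.
by rewrite sumEFin lee_fin sumr_const card_ffun !card_ord -[leLHS]mulr_natl natrX.
Qed.

Lemma hausdorff_dim_bounded_le M A : 0 < M ->
  (forall x, A x -> forall i, `|x 0 i| < M) ->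
  (hausdorff_dim A <= (d%:R : R)%:E)%E.
Proof.
move=> M0 AM; apply/lee_addgt0Pr => e e0; rewrite -EFinD.
apply: ereal_inf_lbound; exists (d%:R + e) => //.
have de : (d%:R : R) < d%:R + e by rewrite ltrDl.
split; first by rewrite (le_trans _ (ltW de)).
exact: hausdorff_measure_bounded0 de M0 AM.
Qed.

Lemma hausdorff_dim_lebesgue_ge A : (0 < d)%N -> (0 < lebesgue_outer A)%E ->
  ((d%:R : R)%:E <= hausdorff_dim A)%E.
Proof.
move=> d0 A0; apply: le_ereal_inf_tmp => _ [s [s0 As0] <-].
rewrite lee_fin leNgt; apply/negP => sd.
have := lebesgue_outer_le_premeasure s A d0 (ltW sd).
have -> : hausdorff_premeasure s 1 A = 0%E.
  apply/eqP; rewrite eq_le hausdorff_premeasure_ge0 andbT -As0.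
  exact: hausdorff_premeasure_le_measure.
by rewrite mule0 leNgt A0.
Qed.

End hausdorff_theory.

(** * Kakeya sets of maps with countably many values *)

Lemma kakeya_set_coord_le {R : realType} {d : nat} (g : bmap R d) x i :
  kakeya_set g x -> `|x 0 i| <= supnorm g + 2^-1.
Proof.
move=> [u _ [t /=]]; rewrite in_itv/= -ler_norml => t2 ->.
apply: le_trans (ler_coord_enorm _ _ _ _) _; apply: le_trans (ler_enormD _ _) _.
by rewrite enormZ (eqP (valP u)) mulr1 lerD// enorm_supnorm.
Qed.

(** The point [x] is [enorm x] times the unit vector [u] in its direction, so it
    lies on the centred unit segment in direction [u]; [c k] is the value
    of [g] in that direction. *)
Lemma ball_sub_kakeya_translates {R : realType} {d : nat} (g : bmap R d)
    (c : nat -> 'rV[R]_d) x :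
    (forall p, exists k, g p = c k) -> 0 < enorm x <= 2^-1 ->
  exists k, kakeya_set g (x + c k).
Proof.
move=> gc /andP[x0 x2].
have u1 : enorm ((enorm x)^-1 *: x) == 1.
  by rewrite enormZ gtr0_norm ?invr_gt0// mulVf// gt_eqF.
pose u : sphere R d := exist _ ((enorm x)^-1 *: x) u1.
have [k guk] := gc (to_psphere u); exists k; exists u => //.
exists (enorm x).
  by rewrite /= in_itv/= x2 andbT (le_trans _ (ltW x0))// oppr_le0 invr_ge0.
by rewrite /= guk scalerA divff ?gt_eqF// scale1r addrC.
Qed.

(** Otherwise the translates of [kakeya_set g] by the vectors [- c k] would be
    null sets covering a cube. *)
Lemma lebesgue_outer_kakeya_gt0 {R : realType} {d : nat} (g : bmap R d)
    (c : nat -> 'rV[R]_d) : (0 < d)%N ->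
  (forall p, exists k, g p = c k) -> (0 < lebesgue_outer (kakeya_set g))%E.
Proof.
move=> d0 gc; rewrite lt0e lebesgue_outer_ge0 andbT; apply/eqP => K0.
(* the cube [l, u]^d avoids the origin and lies in the ball of radius 1/2 *)
pose l : R := (4 * d%:R)^-1; pose u : R := (2 * d%:R)^-1.
have dR0 : 0 < d%:R :> R by rewrite ltr0n.
have l0 : 0 < l by rewrite invr_gt0 mulr_gt0.
have lu : l < u by rewrite ltf_pV2 ?posrE ?mulr_gt0// ltr_pM2r// ltr_nat.
pose Q := [set x : 'rV[R]_d | forall i, l <= x 0 i <= u].
have QK : Q `<=` \bigcup_k [set (y - c k)%R | y in kakeya_set g].
  move=> x Qx; have [k Kx] : exists k, kakeya_set g (x + c k).
    apply: ball_sub_kakeya_translates => //; apply/andP; split.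
      have /andP[lx _] := Qx (Ordinal d0).
      apply: lt_le_trans (ler_coord_enorm _ _ x (Ordinal d0)).
      by rewrite gtr0_norm (lt_le_trans l0).
    have -> : 2^-1 = d%:R * u by rewrite /u; field; rewrite gt_eqF.
    apply: enorm_le_coord => [i|]; last by rewrite (le_trans (ltW l0))// ltW.
    have /andP[lx xu] := Qx i.
    by rewrite ger0_norm// (le_trans (ltW l0)).
  by exists k => //; exists (x + c k) => //; rewrite addrK.
have := lebesgue_outer_cube R d l u (ltW lu); apply/negP; rewrite -ltNge.
apply: le_lt_trans (le_lebesgue_outer _ _ QK) _.
apply: le_lt_trans (lebesgue_outer_sigma_subadditive _) _.
rewrite eseries0 => [|k _ _].
  by rewrite lte_fin exprn_gt0// subr_gt0.
apply/eqP; rewrite eq_le lebesgue_outer_ge0 andbT -K0.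
exact: lebesgue_outer_translate.
Qed.

(** Rounding down to multiples of [e] moves each coordinate by less than [e], and
    the grid is countable because ['rV[int]_d] is. *)
Lemma countable_valued_approx {R : realType} {d : nat} (f : bmap R d) e :
  0 < e -> exists g : bmap R d,
    (exists c : nat -> 'rV[R]_d, forall p, exists k, g p = c k) /\
    supnorm (f - g) <= d%:R * e.
Proof.
move=> e0.
pose grid (z : 'rV[int]_d) : 'rV[R]_d := \row_i (e * (z 0 i)%:~R).
pose z p := \row_i Num.floor (f p 0 i / e).
have fz p : enorm (f p - grid (z p)) <= d%:R * e.
  apply: enorm_le_coord => [i|]; last exact: ltW.
  have /andP[z1 z2] := floor_itv (f p 0 i / e).
  rewrite !mxE; move: z1 z2; rewrite intrD ler_pdivlMr// ltr_pdivrMr// => z1 z2.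
  by rewrite ger0_norm; lra.
have gB : (fun p => grid (z p)) \in @bmap_pred R d.
  apply/asboolP; exists (supnorm f + d%:R * e) => p.
  have -> : grid (z p) = f p + (-1) *: (f p - grid (z p)).
    by rewrite scaleN1r opprB addrC subrK.
  apply: le_trans (ler_enormD _ _) _.
  by rewrite enormZ normrN1 mul1r lerD// enorm_supnorm.
exists (BMap gB); split.
  exists (fun k => oapp grid 0 (choice.unpickle k)) => p.
  by exists (choice.pickle (z p)); rewrite choice.pickleK.
by apply: supnorm_le => [|p]; [rewrite mulr_ge0// ltW|exact: fz].
Qed.

Theorem proposition5p2 (R : realType) (d : nat) (hd : (0 < d)%N) :
  dense [set f : bmap R d |
    (0 < lebesgue_outer (kakeya_set f))%E /\
    hausdorff_dim (kakeya_set f) = (d%:R : R)%:E].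
Proof.
move=> O [f Of] oO.
have /nbhs_ballP[r /= r0 rO] : nbhs f O by apply: open_nbhs_nbhs; split.
have dR0 : 0 < d%:R :> R by rewrite ltr0n.
have e0 : 0 < r / (2 * d%:R) by rewrite divr_gt0// mulr_gt0.
have [g [[c gc] fg]] := countable_valued_approx f _ e0.
have K0 := lebesgue_outer_kakeya_gt0 g c hd gc.
exists g; split.
  apply: rO; rewrite -ball_normE /=; apply: le_lt_trans fg _.
  have -> : d%:R * (r / (2 * d%:R)) = r / 2 by field; rewrite gt_eqF.
  by rewrite ltr_pdivrMr// ltr_pMr// ltr1n.
split=> //; apply/eqP; rewrite eq_le hausdorff_dim_lebesgue_ge// andbT.
apply: (hausdorff_dim_bounded_le (supnorm g + 1)).
  by rewrite ltr_wpDl// supnorm_ge0.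
move=> x Kx i; apply: le_lt_trans (kakeya_set_coord_le g x i Kx) _.
by rewrite ltrD2l invf_lt1// ltr1n.
Qed.
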